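(* (i) $p_n(\mathrm{id},\sigma)$ does not depend on $\sigma^{-1}_n$, the position in $\sigma$ of card number $n$ (that is, if two permutations in $S_n$ have cards $1,\dots,n-1$ in the same relative order, then they have the same probability under $p_n(\mathrm{id},\cdot)$). (ii) Let $\sigma',\sigma''\in S_n$. If $I_j(\sigma')\le I_j(\sigma'')$ for all $j\in\{2,\dots,n-1\}$, then $$p_n(\mathrm{id},\sigma')\ge p_n(\mathrm{id},\sigma''),$$ with strict inequality holding if $I_j(\sigma')<I_j(\sigma'')$ for some $j\in\{2,\dots,n-1\}$.
   Context: A permutation $\sigma\in S_n$ is viewed as a deck of cards numbered $1,\dots,n$ laid out in a row, where $\sigma_j$ is the number of the card in the $j$-th position from the left; thus $\sigma^{-1}_i$ is the position of the card numbered $i$. The card-cyclic to random insertion shuffle removes each of the $n$ cards exactly once and immediately reinserts it in a position chosen uniformly from the $n$ possible positions (independently of the other insertions); the removals and reinsertions are performed one card at a time in the original left-to-right order of the cards. Starting from the identity $\mathrm{id}$ (cards in increasing order from left to right), the cards are thus removed and reinserted in the order $1,2,\dots,n$, and after card $j$ is reinserted in ''position $k$'' it is the $k$-th card from the left. $p_n(\mathrm{id},\sigma)$ denotes the probability that the deck is in state $\sigma$ after one such shuffle started from $\mathrm{id}$. For $2\le j\le n-1$, $I_j(\sigma)=\sum_{k=1}^{j-1}1_{\{\sigma^{-1}_k>\sigma^{-1}_j\}}$ is the number of inversions in $\sigma$ involving the card numbered $j$ and a card numbered less than $j$, i.e. the number of cards with number less than $j$ lying to the right of card $j$. *)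

(* Defs.v *)
From HB Require Import structures.
From mathcomp Require Import all_boot all_order all_fingroup all_algebra.

Set Implicit Arguments.
Unset Strict Implicit.
Unset Printing Implicit Defensive.

Import Order.TTheory GRing.Theory Num.Theory.

Local Open Scope ring_scope.

(* Cards and positions are both numbered from 0: card m or position m of
   {1, ..., n} is the element of 'I_n with value m.-1.  A deck s : 'S_n has
   card s j in position j, so card i is in position s^-1%g i. *)

Definition deck (n : nat) (s : 'S_n) : seq 'I_n := [seq s j | j <- enum 'I_n].

(* After the move there are exactly k cards to the left of card c. *)
Definition reinsert (n : nat) (c k : 'I_n) (d : seq 'I_n) : seq 'I_n :=
  take k (rem c d) ++ c :: drop k (rem c d).

(* The j-th move takes the card that was j-th from the left in the starting
   deck s, wherever it is now, and reinserts it in position k j. *)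
Definition ccr_shuffle (n : nat) (s : 'S_n) (k : {ffun 'I_n -> 'I_n}) :
    seq 'I_n :=
  foldl (fun d j => reinsert (s j) (k j) d) (deck s) (enum 'I_n).

(* Transition probability from s to t: the n reinsertion positions are
   independent and uniform, so each k has mass \prod_(j < n) n^-1. *)
Definition ccr_prob (n : nat) (s t : 'S_n) : rat :=
  \sum_(k : {ffun 'I_n -> 'I_n} | ccr_shuffle s k == deck t)
    \prod_(j < n) (n%:R)^-1.

Definition card_inv (n : nat) (j : 'I_n) (s : 'S_n) : nat :=
  (\sum_(k < n | (k < j)%N) (s^-1%g j < s^-1%g k)%N)%N.

(* Main.v *)
Require Import Defs.
From mathcomp Require Import all_boot all_order all_fingroup all_algebra.
From mathcomp Require Import zify.

(** Run the shuffle backwards from the target.  After the first m cards have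
    moved, the unmoved ones are still in increasing order, so card m lay in
    front of every other unmoved card just before it was removed; undoing its
    move therefore puts it anywhere within the initial run of moved cards.
    Only the length l of that run matters from then on: undoing the move of
    card m first shortens the run by one when the rank of card m among the
    smaller cards is less than l, and the new run has any length up to what
    remains.  The number of histories is thus a function of the ranks,
    rank m = m - I_m, and it grows with each of them.  Card n-1 has rank
    less than l = n in any case, so its rank is irrelevant. *)

Set Implicit Arguments.
Unset Strict Implicit.
Unset Printing Implicit Defensive.

Import Order.TTheory GRing.Theory Num.Theory.

Local Open Scope nat_scope.

(* Histories of m moves, the smaller cards having ranks [r], that leave [l]
   moved cards in front of the first unmoved one. *)
Fixpoint paths (r : nat -> nat) (m l : nat) : nat :=
  if m is m'.+1 then \sum_(i < (l - (r m' < l)).+1) paths r m' i else 1.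

(** * Monotonicity of the path count in the ranks *)

Lemma eq_paths (r r' : nat -> nat) (m l : nat) :
  (forall j, j < m -> r j = r' j) -> paths r m l = paths r' m l.
Proof.
elim: m l => //= m IHm l eq_r; rewrite eq_r //.
by apply: eq_bigr => i _; apply: IHm => j ltjm; apply/eq_r/ltnW.
Qed.

Lemma paths_gt0 (r : nat -> nat) (m l : nat) : 0 < paths r m l.
Proof. by elim: m l => //= m IHm l; rewrite big_ord_recl ltn_addr. Qed.

Lemma leq_sum_prefix (f g : nat -> nat) (a b : nat) :
  a <= b -> (forall i, f i <= g i) -> \sum_(i < a) f i <= \sum_(i < b) g i.
Proof.
move=> le_ab le_fg; rewrite -(subnKC le_ab) big_split_ord /=.
by rewrite (leq_trans _ (leq_addr _ _)) ?leq_sum.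
Qed.

Lemma ltn_sum_prefix (f g : nat -> nat) (a b i0 : nat) :
  a <= b -> (forall i, f i <= g i) -> i0 < a -> f i0 < g i0 ->
  \sum_(i < a) f i < \sum_(i < b) g i.
Proof.
move=> le_ab le_fg lt_i0a lt_fg.
apply: leq_trans (leq_sum_prefix le_ab (fun i => leqnn (g i))).
rewrite (bigD1 (Ordinal lt_i0a)) //= [ltnRHS](bigD1 (Ordinal lt_i0a)) //=.
by rewrite -addSn leq_add ?leq_sum.
Qed.

(** A larger rank is below [l] less often, so the range of summation can only grow with the
    ranks. *)
Lemma leq_paths (r r' : nat -> nat) (m l : nat) :
  (forall j, j < m -> r' j <= r j) -> paths r' m l <= paths r m l.
Proof.
elim: m l => //= m IHm l le_r; apply: leq_sum_prefix => [|i].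
  by have := le_r m (ltnSn m); lia.
by apply: IHm => j ltjm; apply/le_r/ltnW.
Qed.

(** The bound [l < m] keeps the strict term inside the range of the next sum. *)
Lemma ltn_paths (r r' : nat -> nat) (j m : nat) :
  (forall i, i < m -> r' i <= r i) -> j < m -> r' j < r j <= j ->
  exists2 l, l < m & paths r' m l < paths r m l.
Proof.
elim: m => // m IHm le_r; rewrite ltnS => le_jm /andP[lt_r le_rj].
have le_rm i : i < m -> r' i <= r i by move=> ?; apply/le_r/ltnW.
have le_p i : paths r' m i <= paths r m i by apply: leq_paths.
have [eq_jm|lt_jm] := leqP m j.
  have eq_mj : m = j by lia.
  rewrite {m le_jm}eq_mj in IHm le_r le_rm le_p eq_jm *.
  (* At run length [r j] the indicator is 1 for [r'] and 0 for [r], so the sum for [r] has one more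
     term, which is positive. *)
  exists (r j) => //=; rewrite ltnn lt_r subn0.
  have ->: (r j - true).+1 = r j by lia.
  rewrite [ltnRHS]big_ord_recr /= -addn1 leq_add ?paths_gt0 //.
  by apply: leq_sum.
have [|l lt_lm lt_p] := IHm le_rm lt_jm; first by rewrite lt_r.
(* At run length [m] both sums have at least [m] terms, hence contain the term [l]. *)
exists m => //=; apply: (@ltn_sum_prefix _ _ _ _ l) => //; last by lia.
by have := le_r m (ltnSn m); lia.
Qed.

(** * Decks and single reinsertions *)

Section Decks.

Variable n : nat.
Implicit Types (d e : seq 'I_n) (c i : 'I_n) (k : {ffun 'I_n -> 'I_n}).

Definition is_deck d := perm_eq d (enum 'I_n).

Lemma deck_uniq d : is_deck d -> uniq d.
Proof. by move=> /perm_uniq ->; apply: enum_uniq. Qed.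

Lemma deck_mem d c : is_deck d -> c \in d.
Proof. by move=> /perm_mem ->; rewrite mem_enum. Qed.

Lemma deck_size d : is_deck d -> size d = n.
Proof. by move=> /perm_size ->; rewrite size_enum_ord. Qed.

Lemma is_deck_deck (s : 'S_n) : is_deck (deck s).
Proof.
apply: uniq_perm; rewrite ?(map_inj_uniq (@perm_inj _ s)) ?enum_uniq //.
move=> c; rewrite mem_enum; apply/mapP.
by exists (s^-1%g c); rewrite ?mem_enum ?permKV.
Qed.

Lemma reinsert_is_deck c i d : is_deck d -> is_deck (reinsert c i d).
Proof.
move=> dd; apply: perm_trans (dd); rewrite /reinsert -cat1s perm_catCA cat1s.
by rewrite cat_take_drop perm_sym perm_to_rem ?deck_mem.
Qed.

Lemma size_rem_deck c d : is_deck d -> size (rem c d) = n.-1.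
Proof. by move=> dd; rewrite size_rem ?deck_mem ?deck_size. Qed.

Lemma notin_rem c d : is_deck d -> c \notin rem c d.
Proof. by move=> /deck_uniq Ud; rewrite mem_rem_uniqF. Qed.

Lemma index_reinsert c i d : is_deck d -> index c (reinsert c i d) = i.
Proof.
move=> dd; rewrite /reinsert index_cat ifN; last first.
  by apply: contra (notin_rem c dd); apply: mem_take.
rewrite /= eqxx addn0 size_takel // size_rem_deck //.
by rewrite -ltnS (ltn_predK (ltn_ord i)).
Qed.

Lemma rem_reinsert c i d : is_deck d -> rem c (reinsert c i d) = rem c d.
Proof.
move=> dd; have cN := notin_rem c dd.
rewrite rem_filter ?deck_uniq ?reinsert_is_deck //.
rewrite /reinsert filter_cat /= eqxx /= -filter_cat cat_take_drop.
apply/all_filterP/allP => x xd /=; apply: contraNneq cN => eq_xc.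
by rewrite -{1}eq_xc.
Qed.

Lemma reinsert_index c i d :
  is_deck d -> i = index c d :> nat -> reinsert c i d = d.
Proof.
move=> dd eq_i; have := deck_mem c dd; rewrite /reinsert eq_i remE => cd.
have ltcd : index c d < size d by rewrite index_mem.
rewrite take_cat drop_cat size_takel ?(ltnW ltcd) // ltnn subnn take0 drop0 cats0.
by rewrite -{2}(nth_index c cd) -drop_nth // cat_take_drop.
Qed.

(** Both sides say that [d] and [e] agree once [c] is removed, with [c] at [a] in [d] and at [i] in
    [e]. This is what undoes a move. *)
Lemma reinsert_sym c (a i : 'I_n) d e : is_deck d -> is_deck e ->
  (reinsert c a e == d) && (i == index c e :> nat) =
  (e == reinsert c i d) && (a == index c d :> nat).
Proof.
move=> dd de; apply/andP/andP=> -[/eqP + /eqP].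
- move=> <- eq_i; rewrite index_reinsert // eqxx; split=> //.
  by rewrite /reinsert rem_reinsert // -/(reinsert c i e) reinsert_index.
- move=> -> eq_a; rewrite index_reinsert // eqxx; split=> //.
  by rewrite /reinsert rem_reinsert // -/(reinsert c a d) reinsert_index.
Qed.

(** * Counting the choices that lead to a given deck *)

Definition state (m : nat) k :=
  foldl (fun d j => reinsert j (k j) d) (enum 'I_n) (take m (enum 'I_n)).

Lemma stateS c k : state c.+1 k = reinsert c (k c) (state c k).
Proof.
rewrite /state (take_nth c) ?size_enum_ord // -cats1 foldl_cat /=.
by rewrite nth_ord_enum.
Qed.

Lemma state_is_deck m k : is_deck (state m k).
Proof.
rewrite /state; elim/last_ind: (take _ _) => [|s c IHs] /=.
  exact: perm_refl.
by rewrite -cats1 foldl_cat /= reinsert_is_deck.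
Qed.

Lemma eq_state m k k' : m <= n ->
  (forall j : 'I_n, j < m -> k j = k' j) -> state m k = state m k'.
Proof.
elim: m => [|m IHm] lt_mn eq_k; first by rewrite /state take0.
rewrite -[m]/(val (Ordinal lt_mn)) !stateS eq_k //=.
by rewrite IHm ?(ltnW lt_mn) // => j ltjm; apply/eq_k/ltnW.
Qed.

Lemma ccr_shuffle1 k : ccr_shuffle 1%g k = state n k.
Proof.
rewrite /ccr_shuffle /state take_oversize ?size_enum_ord //.
have -> : deck 1%g = enum 'I_n.
  by rewrite /deck (eq_map (@perm1 _)) map_id.
(* The starting decks are generalised apart from the list of moves, since they change along the
   induction. *)
elim: (enum _) {1 3}(enum _) => //= c s IHs d; rewrite perm1 IHs //.
Qed.

(* Swapping the values [a] and [b] at [c] shows that all values of [k c] are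
   equally frequent. *)
Lemma card_fix_coord (P : pred {ffun 'I_n -> 'I_n}) c (a : 'I_n) :
  (forall k k', (forall j, j != c -> k j = k' j) -> P k = P k') ->
  n * #|[pred k | P k & k c == a]| = #|[pred k | P k]|.
Proof.
move=> indepP; rewrite -[RHS]sum1_card (partition_big (fun k => k c) xpredT) //=.
rewrite -[n in n * _]card_ord -sum_nat_const.
apply: eq_bigr => b _; rewrite -sum1_card.
pose h k := [ffun j => if j == c then tperm a b (k j) else k j].
have hK : involutive h.
  move=> k; apply/ffunP=> j; rewrite !ffunE.
  by case: eqP => // _; rewrite tpermK.
rewrite (reindex_inj (inv_inj hK)) /=; apply: eq_bigl => k.
rewrite !inE ffunE eqxx (indepP (h k) k); last first.
  by move=> j /negPf jc; rewrite ffunE jc.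
by rewrite (can2_eq (tpermK a b) (tpermK a b)) tpermL.
Qed.

(** Whole choice functions are counted, so for [m <= n] each choice of the first [m] positions
    counts [n ^ (n - m)] times. *)
Definition reach (m : nat) d := #|[pred k | state m k == d]|.

(** Histories are split by the position [i] of [c] before its move. The previous deck is then
    [reinsert c i d], and [k c] must be the position of [c] in [d], which one choice in [n]
    satisfies. *)
Lemma reachS c d : is_deck d ->
  n * reach c.+1 d = \sum_(i < n) reach c (reinsert c i d).
Proof.
move=> dd; have lt_ix e : is_deck e -> index c e < n.
  by move=> de; rewrite -[ltnRHS](deck_size de) index_mem deck_mem.
pose a := Ordinal (lt_ix d dd).
rewrite /reach -sum1_card (partition_big
  (fun k => Ordinal (lt_ix _ (state_is_deck c k))) xpredT) //= big_distrr /=.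
apply: eq_bigr => i _; rewrite sum1_card -(@card_fix_coord _ c a); last first.
  move=> k k' eq_k; congr (_ == _); apply: eq_state; first exact: ltnW.
  by move=> j ltjc; apply: eq_k; rewrite neq_ltn ltjc.
congr (_ * _); apply: eq_card => k; rewrite [LHS]unfold_in !inE stateS.
have := @reinsert_sym c (k c) i d (state c k) dd (state_is_deck c k).
by rewrite -!val_eqE /= => <-; rewrite [i == _ :> nat]eq_sym.
Qed.

(** * Ranks, the initial run and the order of unmoved cards when a move is undone *)

Definition rank d (m : nat) := index m [seq x <- map val d | x <= m].

(* This is [n] when no card is at least [m]. *)
Definition lead (m : nat) d := find (fun x : 'I_n => m <= x) d.

Lemma rank_reinsert c i d m : is_deck d -> m < c ->
  rank (reinsert c i d) m = rank d m.
Proof.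
move=> dd lt_mc; rewrite /rank !filter_map; congr (index _ (map _ _)).
rewrite /reinsert filter_cat /= leqNgt lt_mc /= -filter_cat cat_take_drop.
rewrite rem_filter ?deck_uniq // -filter_predI; apply: eq_filter => x /=.
by case: eqP => [->|_]; rewrite ?andbT ?andbF // leqNgt lt_mc.
Qed.

Lemma find_leq_count (T : Type) (p : pred T) (s : seq T) :
  find p s <= count (predC p) s.
Proof. by elim: s => //= x s IHs; case: (p x). Qed.

Lemma rank_cat c d1 d2 : c \notin d1 ->
  rank (d1 ++ c :: d2) c = count (fun x : 'I_n => x <= c) d1.
Proof.
move=> cN1; rewrite /rank map_cat filter_cat /= leqnn index_cat ifN /= ?eqxx.
  by rewrite addn0 size_filter count_map.
by rewrite mem_filter leqnn /= (mem_map val_inj).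
Qed.

(** If a larger card precedes [c], the whole run lies to the left of [c] and consists of smaller
    cards, so the rank is at least its length. Otherwise [c] is in the run, and its rank counts only
    the cards of the run before it. *)
Lemma lead_rem c d : is_deck d ->
  lead c.+1 (rem c d) = lead c.+1 d - (rank d c < lead c.+1 d).
Proof.
move=> dd; have Ud := deck_uniq dd; move: (deck_mem c dd).
rewrite /lead => /splitPr def_d; case: def_d Ud => d1 d2.
rewrite cat_uniq /= negb_or => /and3P[_ /andP[cN1 _] _].
set p := fun x : 'I_n => _.
have -> : rem c (d1 ++ c :: d2) = d1 ++ d2.
  rewrite remE index_cat (negPf cN1) /= eqxx addn0.
  by rewrite take_size_cat // drop_cat ltnNge leqnSn /= subSnn /= drop0.
have -> : rank (d1 ++ c :: d2) c = count (predC p) d1.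
  by rewrite rank_cat //; apply: eq_count => x; rewrite /= -leqNgt.
have pcF : p c = false by rewrite /p ltnn.
rewrite !find_cat /= pcF; have := find_leq_count p d1.
case: ifP => [_ | /negbT]; first by lia.
rewrite has_count => p1N; have := count_predC p d1; lia.
Qed.

Definition in_order (m : nat) d :=
  sorted ltn [seq val x | x : 'I_n <- d & m <= x].

Lemma leq_rem_deck c d x : is_deck d -> x \in rem c d -> (c <= x) = (c < x).
Proof.
move=> dd xd; rewrite leq_eqVlt; case: eqP => // /val_inj eq_cx.
by move: xd; rewrite -eq_cx (negPf (notin_rem c dd)).
Qed.

Lemma has_take_lead c i d : is_deck d ->
  has (leq c \o val) (take i (rem c d)) = (lead c.+1 (rem c d) < i).
Proof.
move=> dd; set e := rem c d.
have -> : has (leq c \o val) (take i e) = has (ltn c \o val) (take i e).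
  by apply: eq_in_has => x /mem_take /= /leq_rem_deck ->.
rewrite /lead; have le_i : i <= size e.
  by rewrite size_rem_deck // -ltnS (ltn_predK (ltn_ord i)).
have [has_e|hasN_e] := boolP (has (ltn c \o val) e); first exact: has_take_leq.
(* With no larger card, [lead] defaults to [size e], which [i] cannot exceed. *)
rewrite (hasNfind hasN_e) ltnNge le_i; apply/negbTE.
by apply: contra hasN_e => /hasP[x /mem_take xe px]; apply/hasP; exists x.
Qed.

Lemma lead_reinsert c i d : is_deck d -> i <= lead c.+1 (rem c d) ->
  lead c (reinsert c i d) = i.
Proof.
move=> dd le_i; rewrite /lead /reinsert find_cat.
rewrite -/(leq c \o val) has_take_lead // ltnNge le_i /= leqnn addn0.
by rewrite size_takel // size_rem_deck // -ltnS (ltn_predK (ltn_ord i)).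
Qed.

(** Once [c] counts as unmoved it is the smallest such card, so it must precede all the others: the
    first [i] remaining cards contain none above [c]. *)
Lemma in_order_reinsert c i d : is_deck d ->
  in_order c (reinsert c i d) = in_order c.+1 d && (i <= lead c.+1 (rem c d)).
Proof.
move=> dd; have -> : in_order c.+1 d = in_order c.+1 (rem c d).
  rewrite /in_order rem_filter ?deck_uniq // -filter_predI.
  congr (sorted _ (map _ _)); apply: eq_filter => x /=.
  by case: eqP => [->|_]; rewrite ?andbT // ltnn.
rewrite /in_order /reinsert leqNgt -has_take_lead //.
set e := rem c d; set p := leq c \o val.
have -> : [seq x : 'I_n <- e | c < x] = [seq x <- e | p x].
  by apply: eq_in_filter => x /leq_rem_deck /= <-.
rewrite filter_cat /= leqnn; set A := filter _ (take i e).
set B := filter _ (drop i e).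
have defAB : filter p e = A ++ B by rewrite -filter_cat cat_take_drop.
have gtc x : x \in A ++ B -> c < x.
  by rewrite -defAB mem_filter => /andP[cx /(leq_rem_deck dd) <-].
rewrite has_filter -/A defAB negbK.
case: A gtc {defAB} => [|x A] gtc /=.
  rewrite andbT path_sortedE; last exact: ltn_trans.
  by rewrite (_ : all _ _) //; apply/allP => _ /mapP[x xB ->]; apply: gtc.
(* Sortedness would make the unmoved card [x], to the left of [c], smaller than [c]. *)
rewrite (_ : (x :: A == [::]) = false) // andbF; apply/negP.
move=> /(order_path_min ltn_trans) /allP /(_ (val c)).
rewrite map_cat mem_cat /= mem_head orbT => /(_ isT) /=.
by rewrite ltnNge ltnW // gtc ?mem_head.
Qed.

Lemma in_order0 d : is_deck d -> in_order 0 d = (enum 'I_n == d).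
Proof.
move=> dd; rewrite /in_order filter_predT.
apply/idP/eqP => [sd|<-]; last by rewrite val_enum_ord iota_ltn_sorted.
apply: (inj_map val_inj); rewrite val_enum_ord.
apply: (irr_sorted_eq ltn_trans ltnn) => //; first exact: iota_ltn_sorted.
by move=> x; rewrite -val_enum_ord (perm_mem (perm_map val dd)).
Qed.

(** * From counts to the transition probability, and from ranks to inversions *)

Lemma reach_paths d m : m <= n -> is_deck d ->
  n ^ m * reach m d = n ^ n * (in_order m d * paths (rank d) m (lead m d)).
Proof.
elim: m d => [|m IHm] d lt_mn dd.
  rewrite mul1n muln1 in_order0 // /reach /state take0 /=.
  case: eqP => _; last by rewrite muln0 eq_card0.
  by rewrite muln1 eq_cardT // -cardE card_ffun card_ord.
pose c := Ordinal lt_mn; rewrite expnSr -mulnA -[m]/(val c) reachS //.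
rewrite big_distrr /= in IHm *.
under eq_bigr => i _.
  rewrite IHm ?(ltnW lt_mn) ?reinsert_is_deck // (in_order_reinsert c) //.
  over.
rewrite -big_distrr /=; congr (_ * _).
case: in_order => /=; last by rewrite big1 // => i _; rewrite mul0n.
rewrite mul1n -(@lead_rem c) //; set l := lead m.+1 _.
(* The run fits into the [n.-1] cards other than [c], so the positions up to [l] are all available
   and the sum over them is the recursion of [paths]. *)
have le_l : l.+1 <= n.
  rewrite -[n in _ <= n](ltn_predK lt_mn) ltnS -(size_rem_deck c dd).
  exact: find_size.
rewrite -(@big_ord_narrow _ _ _ _ _ (fun i => paths (rank d) m i) le_l).
rewrite [RHS]big_mkcond /=.
apply: eq_bigr => i _; rewrite ltnS.
case: (leqP i l) => [le_il|_]; last by rewrite mul0n.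
rewrite mul1n (@lead_reinsert c) //; apply: eq_paths => j ltjm.
exact: rank_reinsert.
Qed.

Lemma ccr_prob1 (s : 'S_n) :
  ccr_prob 1%g s = ((n%:R^-1 ^+ n) *+ paths (rank (deck s)) n n)%R.
Proof.
rewrite /ccr_prob prodr_const card_ord sumr_const.
have ds := is_deck_deck s; congr (_ *+ _)%R.
transitivity (reach n (deck s)).
  by apply: eq_card => k; rewrite [LHS]unfold_in inE ccr_shuffle1.
have := reach_paths (leqnn n) ds.
have -> : in_order n (deck s).
  rewrite /in_order (@eq_filter _ _ pred0) ?filter_pred0 // => x /=.
  by rewrite leqNgt ltn_ord.
have -> : lead n (deck s) = n.
  rewrite /lead hasNfind ?deck_size //; apply/hasPn => x _ /=.
  by rewrite -ltnNge.
rewrite mul1n => /eqP; rewrite eqn_pmul2l => [/eqP //|].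
(* The cancelled factor [n ^ n] is 1 for the empty deck. *)
by rewrite expn_gt0; case: (n).
Qed.

Lemma index_deck (s : 'S_n) c : index c (deck s) = s^-1%g c.
Proof.
rewrite -{1}(permKV s c) /deck index_map; last exact: perm_inj.
exact: index_enum_ord.
Qed.

(** Each of the [c] smaller cards lies either to the left of [c], counted by the rank, or to its
    right, counted by the inversions. *)
Lemma rank_card_inv (s : 'S_n) c : rank (deck s) c + card_inv c s = c.
Proof.
have ds := is_deck_deck s; have Us := deck_uniq ds.
have -> : rank (deck s) c = \sum_(k < n | k < c) (s^-1%g k < s^-1%g c).
  under eq_bigr => k _ do rewrite -!index_deck.
  move: (deck_mem c ds) Us => /splitPr; case: (deck s) / => d1 d2.
  rewrite cat_uniq /= negb_or => /and3P[U1 /andP[cN1 _] _].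
  rewrite rank_cat // -size_filter -(card_uniqP _) ?filter_uniq //.
  rewrite -sum1_card [RHS]big_mkcond [LHS]big_mkcond /=; apply: eq_bigr => k _.
  rewrite mem_filter !index_cat (negPf cN1) /= eqxx addn0 leq_eqVlt.
  case: (ltngtP k c) => //= [lt_kc|/val_inj ->]; last by rewrite (negPf cN1).
  by case: ifP => k1; rewrite ?index_mem ?k1 // ltnNge leq_addr.
rewrite -big_split /=; transitivity (\sum_(k < n | k < c) 1).
  apply: eq_bigr => k lt_kc; have: s^-1%g k != s^-1%g c.
    by rewrite (inj_eq perm_inj) neq_ltn lt_kc.
  by rewrite -val_eqE /=; case: ltngtP.
by rewrite (big_ord_narrow (ltnW (ltn_ord c))) sum1_card card_ord.
Qed.

Lemma rank_deck (s : 'S_n) c : rank (deck s) c = c - card_inv c s.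
Proof. by rewrite -[in RHS](rank_card_inv s c) addnK. Qed.

End Decks.

Local Open Scope ring_scope.

(** The top card has rank at most [n], below the run length [n.+1], so undoing its move always
    shortens the run to [n]; only ranks of smaller cards remain. *)
Lemma ccr_prob1S (n : nat) (s : 'S_n.+1) :
  ccr_prob 1%g s =
  (n.+1%:R^-1 ^+ n.+1) *+ (\sum_(i < n.+1) paths (rank (deck s)) n i)%N.
Proof.
rewrite ccr_prob1 [paths _ _ _]/= -[n in rank _ n]/(val (@ord_max n)).
by rewrite rank_deck /= ltnS leq_subr subSS subn0.
Qed.

Theorem corollary6 (n : nat) :
  (forall s1 s2 : 'S_n,
     (forall i k : 'I_n, (i < n.-1)%N -> (k < n.-1)%N ->
        (s1^-1%g i < s1^-1%g k)%N = (s2^-1%g i < s2^-1%g k)%N) ->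
     ccr_prob 1%g s1 = ccr_prob 1%g s2)
  /\
  (forall s1 s2 : 'S_n,
     (forall j : 'I_n, (0 < j < n.-1)%N -> (card_inv j s1 <= card_inv j s2)%N) ->
     ccr_prob 1%g s1 >= ccr_prob 1%g s2
     /\ ((exists j : 'I_n, (0 < j < n.-1)%N /\ (card_inv j s1 < card_inv j s2)%N) ->
         ccr_prob 1%g s1 > ccr_prob 1%g s2)).
Proof.
case: n => [|n]; first by split=> s1 s2 _; rewrite !ccr_prob1 //; split=> // -[[]].
have w_gt0 : 0 < (n.+1%:R^-1 : rat) ^+ n.+1 by rewrite exprn_gt0 // invr_gt0 ltr0n.
split=> s1 s2 le_inv; rewrite !ccr_prob1S.
  congr (_ *+ _); apply: eq_bigr => i _; apply: eq_paths => j lt_jn.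
  pose c : 'I_n.+1 := Ordinal (ltnW lt_jn : j < n.+1)%N.
  rewrite -[j]/(val c) !rank_deck; congr (_ - _)%N.
  by apply: eq_bigr => k lt_kc; rewrite le_inv //= (ltn_trans lt_kc).
have le_rank j : (j < n -> rank (deck s2) j <= rank (deck s1) j)%N.
  move=> lt_jn; pose c : 'I_n.+1 := Ordinal (ltnW lt_jn : j < n.+1)%N.
  (* The assumption starts at card 1; card 0 has rank 0 in every deck. *)
  rewrite -[j]/(val c) !rank_deck; case: (posnP j) => [j0|j_gt0].
    by rewrite /= j0 !sub0n.
  by rewrite leq_sub2l // le_inv //= j_gt0.
have le_paths i := leq_paths i le_rank.
split=> [|[c [/andP[c_gt0 lt_cn] lt_inv]]].
  by rewrite ler_wpMn2l ?(ltW w_gt0) // leq_sum.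
rewrite ltr_pMn2l //.
(* Rank and inversions add up to [c], so fewer inversions mean a larger rank, still at most [c]. *)
have lt_rank : (rank (deck s2) c < rank (deck s1) c <= c)%N.
  by have := rank_card_inv s1 c; have := rank_card_inv s2 c; lia.
have [l lt_ln lt_l] := ltn_paths le_rank lt_cn lt_rank.
exact: (ltn_sum_prefix (leqnn n.+1) le_paths (ltnW lt_ln) lt_l).
Qed.
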